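(* For every finite simple connected graph $G$, $\mathsf{in}_m(G)=\mathsf{pw}(G)+1$, where $\mathsf{pw}(G)$ is the pathwidth of $G$.
   Context: For $S\subseteq V(G)$, $\partial_G(S)$ is the set of vertices of $S$ having a neighbor in $V(G)\setminus S$. A $k$-search of length $\ell$ on $G$ is a sequence $(S_t)_{t=1}^{\ell}$ of subsets of $V(G)$ with $|S_t|\le k$. Define $\mathsf{FC}_0=\varnothing$, $\mathsf{PC}_{t+1}=\mathsf{FC}_t\cup S_{t+1}$, $\mathsf{FC}_{t+1}=\mathsf{PC}_{t+1}\setminus\partial_G(\mathsf{PC}_{t+1})$. The search is successful if $\mathsf{FC}_\ell=V(G)$, and monotonic if $\mathsf{FC}_i\subseteq\mathsf{FC}_j$ whenever $i\le j$. $\mathsf{in}_m(G)$ is the least $k$ such that a successful monotonic $k$-search on $G$ exists. A path decomposition of $G$ is a sequence $(X_i)_{i=1}^\ell$ of subsets of $V(G)$ such that every edge has both endpoints in some $X_i$, and whenever $i<j<k$ and $v\in X_i\cap X_k$ then $v\in X_j$; its width is $\max_i|X_i|-1$ ($0$ if empty); $\mathsf{pw}(G)$ is the minimum width of a path decomposition. *)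

(* Defs.v *)
From mathcomp Require Import all_boot boolp.
Set Implicit Arguments.
Unset Strict Implicit.
Unset Printing Implicit Defensive.

Record sgraph := SGraph {
  vertex :> finType;
  adj : rel vertex;
  adj_sym : symmetric adj;
  adj_irrefl : irreflexive adj
}.

(* The graph without vertices does not count as connected. *)
Definition connected (G : sgraph) : Prop :=
  0 < #|G| /\ forall u v : G, connect (@adj G) u v.

Definition boundary (G : sgraph) (S : {set G}) : {set G} :=
  [set u in S | [exists v, (v \notin S) && adj u v]].

(* In a search (S_t) with 1 <= t <= l, represented by S : seq {set G}, the set
   S_t is nth set0 S t.-1. *)
Section Search.
Variables (G : sgraph) (S : seq {set G}).

Fixpoint FC (t : nat) : {set G} :=
  if t is t'.+1 then
    let PC := FC t' :|: nth set0 S t' in PC :\: boundary PC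
  else set0.

Definition successful : Prop := FC (size S) = [set: G].

Definition monotonic : Prop :=
  forall i j, i <= j <= size S -> FC i \subset FC j.

Definition is_search (k : nat) : Prop :=
  forall A, A \in S -> #|A| <= k.

End Search.

Definition monotonic_searchable (G : sgraph) (k : nat) : Prop :=
  exists S : seq {set G}, [/\ is_search S k, successful S & monotonic S].

Lemma monotonic_searchable_ex (G : sgraph) :
  exists k, `[< monotonic_searchable G k >].
Proof.
exists #|G|; apply/asboolP; exists [:: [set: G]].
have b0 : boundary [set: G] = set0.
  by apply/setP=> u; rewrite !inE; apply/existsP => -[v]; rewrite inE.
have FC1 : FC [:: [set: G]] 1 = [set: G] by rewrite /= set0U b0 setD0.
split=> [A _||]; [exact: max_card | exact: FC1 |].
move=> i [|[|j]] /andP[ij lej] //; last by rewrite FC1 subsetT.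
by move: ij; rewrite leqn0 => /eqP->.
Qed.

Definition in_m (G : sgraph) : nat := ex_minn (monotonic_searchable_ex G).

Definition path_decomposition (G : sgraph) (X : seq {set G}) : Prop :=
  (forall u v : G, adj u v -> exists2 B, B \in X & (u \in B) && (v \in B)) /\
  (forall i j k (v : G), i < j < k -> k < size X ->
     v \in nth set0 X i -> v \in nth set0 X k -> v \in nth set0 X j).

(* The truncated predecessor gives width 0 to the empty decomposition, and also
   to a decomposition all of whose bags are empty. *)
Definition width (G : sgraph) (X : seq {set G}) : nat :=
  (\max_(B <- X) #|B|).-1.

Definition has_path_decomposition (G : sgraph) (w : nat) : Prop :=
  exists2 X : seq {set G}, path_decomposition X & width X = w.

Lemma has_path_decomposition_ex (G : sgraph) :
  exists w, `[< has_path_decomposition G w >].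
Proof.
exists (width [:: [set: G]]); apply/asboolP; exists [:: [set: G]] => //; split.
  by move=> u v _; exists [set: G]; rewrite !inE.
by move=> i j [|k] v //; rewrite ltn0 andbF.
Qed.

Definition pw (G : sgraph) : nat := ex_minn (has_path_decomposition_ex G).

(* Main.v *)
Require Import Defs.
From mathcomp Require Import all_boot.
From mathcomp Require Import boolp.

(** A path decomposition whose bags cover V(G) is itself a monotonic search:
    if U_t is the union of the first t bags, a vertex of the boundary of U_t has
    an edge that lies in a later bag, hence by interpolation belongs to the next
    bag, so that the search partially clears exactly U_(t+1) at step t+1.
    Conversely, if FC_0, FC_1, ... are the sets cleared by a monotonic search,
    then the sets N[FC_(t+1)] minus FC_t form a path decomposition, and each of
    them is contained in S_(t+1), because N[FC_(t+1)] is contained in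
    PC_(t+1) = FC_t united with S_(t+1). *)

Set Implicit Arguments.
Unset Strict Implicit.
Unset Printing Implicit Defensive.

Section Graph.
Variable G : sgraph.
Implicit Types (A B : {set G}) (S X : seq {set G}) (u v : G).

Lemma pw_le_width X : path_decomposition X -> pw G <= width X.
Proof.
by move=> pdX; rewrite /pw; case: ex_minnP => w _; apply; apply/asboolP; exists X.
Qed.

Lemma pw_attained : exists2 X : seq {set G}, path_decomposition X & width X = pw G.
Proof. by rewrite /pw; case: ex_minnP => w /asboolP. Qed.

Lemma in_m_le k : monotonic_searchable G k -> in_m G <= k.
Proof. by move=> Gk; rewrite /in_m; case: ex_minnP => m _; apply; apply/asboolP. Qed.

Lemma in_m_attained : monotonic_searchable G (in_m G).
Proof. by rewrite /in_m; case: ex_minnP => m /asboolP. Qed.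

Lemma setD_boundaryP A v :
  reflect (v \in A /\ forall u, adj v u -> u \in A) (v \in A :\: boundary A).
Proof.
rewrite !inE; apply: (iffP andP) => -[].
  move=> nbv Av; split=> // u vu; apply: contraNT nbv => Au.
  by rewrite Av; apply/existsP; exists u; rewrite Au.
move=> Av nbv; split=> //; rewrite Av; apply/existsP => -[u /andP[Au /nbv]].
by rewrite (negPf Au).
Qed.

(** Removing the boundary leaves the vertices whose whole closed neighborhood lies in the set, a
    condition that passes to supersets. *)
Lemma setD_boundaryS A B : A \subset B -> A :\: boundary A \subset B :\: boundary B.
Proof.
move=> /subsetP sAB; apply/subsetP => v /setD_boundaryP[Av nbv].
by apply/setD_boundaryP; split=> [|u /nbv]; apply: sAB.
Qed.

Definition bag_union X t : {set G} := \bigcup_(i < t) nth set0 X i.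

Lemma bag_unionP X t v :
  reflect (exists2 i, i < t & v \in nth set0 X i) (v \in bag_union X t).
Proof.
apply: (iffP bigcupP) => [[i _ vi]|[i lt_it vi]]; first by exists i.
by exists (Ordinal lt_it).
Qed.

Lemma mem_nth_lt X i v : v \in nth set0 X i -> i < size X.
Proof. by case: ltnP => // /(nth_default set0) ->; rewrite inE. Qed.

Lemma bag_unionS X s t : s <= t -> bag_union X s \subset bag_union X t.
Proof.
move=> st; apply/subsetP => v /bag_unionP[i lt_is vi].
by apply/bag_unionP; exists i => //; apply: leq_trans st.
Qed.

Lemma FC_path_decomposition X t : path_decomposition X ->
  FC X t = bag_union X t :\: boundary (bag_union X t).
Proof.
move=> [edgeX intX]; elim: t => [|t IHt] /=.
  by rewrite /bag_union big_ord0 set0D.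
suff -> : FC X t :|: nth set0 X t = bag_union X t.+1 by [].
rewrite {}IHt [RHS]big_ord_recr /= -/(bag_union X t).
apply/eqP; rewrite eqEsubset setSU ?subsetDl //=; apply/subsetP => v.
rewrite 2!in_setU => /orP[Uv|->]; last by rewrite orbT.
rewrite orbC; case: (boolP (v \in nth set0 X t)) => //= nXv.
apply/setD_boundaryP; split=> // u vu; apply: contraNT nXv => Uu.
have [B /(nthP set0)[j ltj <-] /andP[vj uj]] := edgeX _ _ vu.
have [i lt_it vi] := bag_unionP _ _ _ Uv.
(* The bag [j] containing the edge cannot be among the first [t], since [u] is in none of them. So
   [v] lies in a bag [i < t] and in a bag [j >= t], hence in bag [t]. *)
have : t <= j by rewrite leqNgt; apply: contra Uu => ?; apply/bag_unionP; exists j.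
rewrite leq_eqVlt => /predU1P[->//|lt_tj].
by apply: intX vi vj; rewrite ?lt_it.
Qed.

Lemma searchable_of_path_decomposition X :
  path_decomposition X -> bag_union X (size X) = [set: G] ->
  monotonic_searchable G (width X).+1.
Proof.
move=> pdX coverX; exists X; split=> [A XA||i j /andP[ij _]].
(* The truncated predecessor is harmless here: [n <= n.-1.+1] also holds for [n = 0]. *)
- by apply: leq_trans (leqSpred _); apply: (@leq_bigmax_seq _ X xpredT (fun B => #|B|)).
- rewrite /successful FC_path_decomposition // coverX; apply/setP => v.
  by rewrite in_setT; apply/setD_boundaryP; split=> [|u _]; rewrite in_setT.
- by rewrite !FC_path_decomposition // setD_boundaryS ?bag_unionS.
Qed.

Definition closed_nbhd A : {set G} :=
  [set v | (v \in A) || [exists u in A, adj u v]].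

Lemma sub_closed_nbhd A v : v \in A -> v \in closed_nbhd A.
Proof. by rewrite inE => ->. Qed.

Lemma adj_closed_nbhd A u v : u \in A -> adj u v -> v \in closed_nbhd A.
Proof.
by move=> Au uv; rewrite inE; apply/orP; right; apply/exists_inP; exists u.
Qed.

Lemma closed_nbhdS A B : A \subset B -> closed_nbhd A \subset closed_nbhd B.
Proof.
move=> /subsetP sAB; apply/subsetP => v; rewrite [in X in X -> _]inE.
by case/orP=> [/sAB/sub_closed_nbhd //|/exists_inP[u /sAB /adj_closed_nbhd]]; apply.
Qed.

Lemma closed_nbhd_FC S t : closed_nbhd (FC S t.+1) \subset FC S t :|: nth set0 S t.
Proof.
apply/subsetP => v; rewrite [in X in X -> _]inE => /orP[/setD_boundaryP[] //|].
by case/exists_inP=> u /setD_boundaryP[_ nbu] /nbu.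
Qed.

Definition search_bag S t : {set G} := closed_nbhd (FC S t.+1) :\: FC S t.

Lemma in_search_bag S t v :
  (v \in search_bag S t) = (v \notin FC S t) && (v \in closed_nbhd (FC S t.+1)).
Proof. exact: in_setD. Qed.

Lemma search_bag_sub S t : search_bag S t \subset nth set0 S t.
Proof. by rewrite subDset closed_nbhd_FC. Qed.

(** Take the last step before either vertex is cleared. If [u] and [v] are adjacent, its bag
    contains both; the case [u = v] yields a nonempty bag. *)
Lemma first_cleared S u v : successful S ->
  exists2 t, t < size S &
    [/\ u \notin FC S t, v \notin FC S t & (u \in FC S t.+1) || (v \in FC S t.+1)].
Proof.
move=> succS; have exP : exists t, (u \in FC S t) || (v \in FC S t).
  by exists (size S); rewrite succS in_setT.
case: (ex_minnP exP) => -[|t]; first by rewrite !inE.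
move=> Ft tmin; exists t; first by apply: tmin; rewrite succS in_setT.
have : ~~ ((u \in FC S t) || (v \in FC S t)).
  by apply/negP => /tmin; rewrite ltnn.
by rewrite negb_or => /andP[].
Qed.

Lemma search_bag_decomposition S : successful S -> monotonic S ->
  path_decomposition (mkseq (search_bag S) (size S)).
Proof.
move=> succS monS; split=> [u v uv|i j k v /andP[ij jk]].
  have [t ltt [nu nv uvF]] := first_cleared u v succS.
  exists (search_bag S t); first by apply: map_f; rewrite mem_iota.
  rewrite !in_search_bag nu nv /=.
  case/orP: uvF => Fuv; first by rewrite sub_closed_nbhd ?(adj_closed_nbhd Fuv).
  by rewrite andbC sub_closed_nbhd ?(adj_closed_nbhd Fuv) // adj_sym.
rewrite size_mkseq => ltk; have ltj := ltn_trans jk ltk.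
rewrite !nth_mkseq ?(ltn_trans ij) // !in_search_bag => /andP[_ vi] /andP[nvk _].
(* Both conditions on [v] are monotone in time: not being cleared passes from [k] down to [j], and
   lying in the closed neighborhood of the cleared set passes from [i] up to [j]. *)
apply/andP; split.
  by apply: contra nvk; apply/subsetP/monS; rewrite (ltnW jk) ltnW.
by apply: subsetP vi; apply/closed_nbhdS/monS; rewrite ltnS (ltnW ij).
Qed.

Lemma pw_lt_searchable k : 0 < #|G| -> monotonic_searchable G k -> pw G < k.
Proof.
move=> /card_gt0P[x _] [S [Sk succS monS]].
have bag_k t : t < size S -> #|search_bag S t| <= k.
  move=> ltt; apply: leq_trans (subset_leq_card (search_bag_sub S t)) _.
  by apply/Sk/mem_nth.
(* Because of the truncation in [width], a bound on the bags gives only width at most [k.-1], which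
   is below [k] only for positive [k]. *)
have k_gt0 : 0 < k.
  have [t ltt [nx _]] := first_cleared x x succS; rewrite orbb => Fx.
  apply: leq_trans (bag_k t ltt); apply/card_gt0P; exists x.
  by rewrite in_search_bag nx sub_closed_nbhd.
rewrite -[k]prednK // ltnS.
apply: leq_trans (pw_le_width (search_bag_decomposition succS monS)) _.
rewrite /width -!subn1 leq_sub2r //; apply/bigmax_leqP_seq => B.
by case/mapP=> t; rewrite mem_iota => /andP[_ ltt] -> _; apply: bag_k.
Qed.

(** Path decompositions are only required to cover edges; a neighbor for every vertex turns this
    into covering all vertices. *)
Lemma connected_has_neighbor v : connected G -> 1 < #|G| -> exists u, adj v u.
Proof.
move=> [_ cG] G1; have [w wv] : exists w, w != v.
  apply/existsP; apply: contraLR G1 => /existsPn allv; rewrite -leqNgt.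
  by apply/card_le1_eqP => a b _ _; rewrite (eqP (negbNE (allv a))) (eqP (negbNE (allv b))).
case/connectP: (cG v w) => -[|u p] /=; first by move=> _ E; rewrite E eqxx in wv.
by case/andP=> vu _ _; exists u.
Qed.

(* On a one-vertex graph the bags of an optimal decomposition may all be empty;
   hence the separate case. *)
Lemma covering_path_decomposition : connected G ->
  exists X : seq {set G}, [/\ path_decomposition X, bag_union X (size X) = [set: G]
              & width X <= pw G].
Proof.
move=> cG; case: (leqP #|G| 1) => [G1|G1].
  exists [:: [set: G]]; split.
  - split=> [u v _|i j [|k] v //]; last by rewrite ltn0 andbF.
    by exists [set: G]; rewrite ?mem_head ?in_setT.
  - by rewrite /bag_union big_ord1.
  - by rewrite /width big_seq1 cardsT -subn1; move: G1; rewrite -subn_eq0 => /eqP->.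
have [X pdX wX] := pw_attained; exists X; split=> //; last by rewrite wX.
apply/setP => v; rewrite in_setT; apply/bag_unionP.
have [u /(pdX.1)[B /(nthP set0)[i lti <-] /andP[vi _]]] := connected_has_neighbor v cG G1.
by exists i.
Qed.

End Graph.

Theorem theorem4p5 (G : sgraph) (hG : connected G) : in_m G = (pw G + 1)%N.
Proof.
rewrite addn1; apply/eqP; rewrite eqn_leq.
rewrite (pw_lt_searchable hG.1 (in_m_attained G)) andbT.
have [X [pdX coverX wX]] := covering_path_decomposition hG.
exact: leq_trans (in_m_le (searchable_of_path_decomposition pdX coverX)) _.
Qed.
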